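(* Let $\lambda>0$ and let $f=h+\overline{g}\in\mathcal{H}$ be a locally univalent harmonic mapping in $\mathbb{D}$. Then $f\in\mathcal{B}_H(\lambda)$ if and only if, for each pair of points $z_1,z_2\in\mathbb{D}$ and each $\theta\in[0,2\pi]$, $$|u_\theta(z_1)-u_\theta(z_2)|\le 2\lambda\, d_h(z_1,z_2),$$ where $u_\theta(z)=\log\big(h'(z)+e^{i\theta}g'(z)\big)$.
   Context: $\mathbb{D}$ is the open unit disk. $\mathcal{H}$ is the class of harmonic mappings $f=h+\overline g$ in $\mathbb{D}$ ($h,g$ analytic in $\mathbb{D}$) with $h(0)=g(0)=h'(0)-1=0$. $\|T_f\|=\sup_{z\in\mathbb{D},\ \theta\in[0,2\pi]}(1-|z|^2)\left|\frac{h''(z)+e^{i\theta}g''(z)}{h'(z)+e^{i\theta}g'(z)}\right|$, with $\|T_f\|=\infty$ if $h'+e^{i\theta}g'$ has a zero in $\mathbb{D}$ for some $\theta$; and $\mathcal{B}_H(\lambda)=\{f\in\mathcal{H}:\|T_f\|\le 2\lambda\}$. $d_h(z,w)=\frac12\log\frac{1+\left|\frac{z-w}{1-\overline{z}w}\right|}{1-\left|\frac{z-w}{1-\overline{z}w}\right|}$ is the hyperbolic distance on $\mathbb{D}$. For a locally univalent harmonic mapping, the functions $h'+e^{i\theta}g'$ have no zeros in $\mathbb{D}$ (Lewy's theorem), and $u_\theta$ denotes an analytic branch of the logarithm on $\mathbb{D}$. *)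

(* Defs.v *)
From Stdlib Require Import Reals ClassicalEpsilon.
From Coquelicot Require Import Coquelicot.
Open Scope R_scope.

Definition disk (z : C) : Prop := Cmod z < 1.

Definition angle (theta : R) : Prop := 0 <= theta <= 2 * PI.

(* Coquelicot has no complex exponential; this is exp (x + iy) = e^x (cos y + i sin y). *)
Definition Cexp (z : C) : C :=
  (exp (fst z) * cos (snd z), exp (fst z) * sin (snd z)).

(* Analyticity is complex differentiability at every point of the open disk;
   the values of [f] off the disk are irrelevant. *)
Definition analytic_on_disk (f : C -> C) : Prop :=
  forall z : C, disk z -> ex_derive (K := C_AbsRing) (V := C_NormedModule) f z.

(* A harmonic mapping f = h + conj g is represented by the pair (h, g), which f
   determines on the disk once g(0) = 0 is imposed. *)
Definition harmonic_map (h g : C -> C) (z : C) : C := (h z + Cconj (g z))%C.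

Definition class_H (h g : C -> C) : Prop :=
  analytic_on_disk h /\ analytic_on_disk g /\
  h (RtoC 0) = RtoC 0 /\ g (RtoC 0) = RtoC 0 /\
  (C_derive h (RtoC 0) - RtoC 1)%C = RtoC 0.

(* Local univalence is local injectivity, not the Jacobian condition. *)
Definition locally_univalent (f : C -> C) : Prop :=
  forall z : C, disk z -> exists r : R, 0 < r /\
    forall w1 w2 : C, disk w1 -> disk w2 ->
      Cmod (w1 - z)%C < r -> Cmod (w2 - z)%C < r -> f w1 = f w2 -> w1 = w2.

Definition rot_sum (h g : C -> C) (theta : R) (z : C) : C :=
  (h z + Cexp (Ci * RtoC theta) * g z)%C.

Definition T_norm (h g : C -> C) : Rbar :=
  if excluded_middle_informative
       (exists (z : C) (theta : R), disk z /\ angle theta /\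
          rot_sum (C_derive h) (C_derive g) theta z = RtoC 0)
  then p_infty
  else Lub_Rbar (fun r : R => exists (z : C) (theta : R),
         disk z /\ angle theta /\
         r = (1 - Cmod z ^ 2) *
             Cmod (rot_sum (C_derive (C_derive h)) (C_derive (C_derive g)) theta z
                   / rot_sum (C_derive h) (C_derive g) theta z)%C).

Definition class_B_H (lambda : R) (h g : C -> C) : Prop :=
  class_H h g /\ Rbar_le (T_norm h g) (Finite (2 * lambda)).

Definition pseudo_hyp (z w : C) : R :=
  Cmod ((z - w) / (RtoC 1 - Cconj z * w))%C.

Definition hyp_dist (z w : C) : R :=
  / 2 * ln ((1 + pseudo_hyp z w) / (1 - pseudo_hyp z w)).

Definition log_branch (F u : C -> C) : Prop :=
  analytic_on_disk u /\ forall z : C, disk z -> Cexp (u z) = F z.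

(* Main.v *)
Require Import Defs.
From Stdlib Require Import Reals Lra.
From Coquelicot Require Import Coquelicot.

(** Write [F] for [h' + e^(i theta) g'] and [u] for its logarithm.  Differentiating
    [F = exp u] gives [F' / F = u'], so the norm [T_norm] is the supremum over
    [theta] and [z] of [(1 - |z|^2) |u'(z)|], and the theorem reduces to a fact
    about a single analytic function [u] on the disk
    ([hyperbolic_lipschitz_iff]): [(1 - |z|^2) |u'(z)| <= M] everywhere exactly
    when [u] is [M]-Lipschitz from the hyperbolic metric to the Euclidean one.

    Both conditions on [u] are invariant under composition with the automorphisms
    [mobius a] of the disk, which move [0] to [a]; so each implication need
    only be proved with one of the points at the origin.  There the hyperbolic
    distance is [artanh |w|], whose derivative along a radius is
    [1 / (1 - t^2)].  A bound on the derivative integrates along the radius to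
    a bound on the growth ([growth_of_derivative_bound]); conversely the growth
    bound [|v(t) - v(0)| <= M artanh t] is an equality at [t = 0] and
    differentiates there to [|v'(0)| <= M] ([derivative_bound_of_growth]).

    The reduction needs [h'] and [g'] to be differentiable, so that [F'] really is
    [h'' + e^(i theta) g''].  Cauchy's theory can be bypassed here: [F] is
    differentiable for every [theta], being the exponential of a differentiable
    function, and [h'] and [g'] are the half-sum and half-difference of the
    functions [F] for [theta = 0] and [theta = pi] ([C_derive_log_rot_sum]).  The
    same logarithms show that [F] has no zeros, so [T_norm] is a genuine
    supremum ([T_norm_le_iff]). *)

(** * Complex derivatives *)

Notation is_Cderive := (@is_derive C_AbsRing C_NormedModule).

Lemma is_Cderive_epsilon (f : C -> C) (z l : C) :
  is_Cderive f z l <->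
  (forall eps : R, 0 < eps -> exists delta : R, 0 < delta /\
     forall w : C, Cmod (w - z)%C < delta ->
       Cmod (f w - f z - (w - z) * l)%C <= eps * Cmod (w - z)%C).
Proof.
  split.
  - intros [_ H] eps Heps.
    destruct (H z (fun P HP => HP) (mkposreal eps Heps)) as [d Hd].
    exists d; split; [apply cond_pos|].
    intros w Hw. exact (Hd w Hw).
  - intros H; split.
    + apply (is_linear_scal_l (K := C_AbsRing) (V := C_NormedModule) l).
    + intros x Hx eps.
      assert (E : z = x)
        by exact (is_filter_lim_locally_unique (K := C_AbsRing) (V := AbsRing_NormedModule C_AbsRing) z x Hx).
      subst x.
      destruct (H eps (cond_pos eps)) as [d [Hd Hw]].
      exists (mkposreal d Hd). intros w Hb. exact (Hw w Hb).
Qed.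

(** The chain rule of the library wants the inner function valued in [C] as a
    normed module over itself, whose uniform structure is given by the modulus,
    whereas [C_NormedModule] carries that of a product.  Derivatives agree because
    only the norm of the target enters their definition. *)
Lemma is_Cderive_comp (f g : C -> C) (z df dg : C) :
  is_Cderive f (g z) df -> is_Cderive g z dg ->
  is_Cderive (fun w => f (g w)) z (dg * df)%C.
Proof.
  intros Hf [[La Ls Ln] Hg].
  apply (is_derive_comp (K := C_AbsRing) (V := C_NormedModule) f g z df dg Hf).
  split; [split; [exact La | exact Ls | exact Ln] | exact Hg].
Qed.

Lemma is_Cderive_scal (a : C) (f : C -> C) (z df : C) :
  is_Cderive f z df -> is_Cderive (fun w => a * f w)%C z (a * df)%C.
Proof.
  intros Hf. rewrite Cmult_comm.
  apply (is_Cderive_comp (fun y => a * y)%C); [|exact Hf].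
  apply is_Cderive_epsilon. intros eps Heps. exists 1; split; [lra|]. intros w _.
  replace (a * w - a * f z - (w - f z) * a)%C with (RtoC 0) by ring.
  rewrite Cmod_0. apply Rmult_le_pos; [lra | apply Cmod_ge_0].
Qed.

Lemma is_Cderive_lincomb (a b : C) (f g : C -> C) (z df dg : C) :
  is_Cderive f z df -> is_Cderive g z dg ->
  is_Cderive (fun w => a * f w + b * g w)%C z (a * df + b * dg)%C.
Proof.
  intros Hf Hg.
  apply (is_derive_plus (K := C_AbsRing) (V := C_NormedModule)
           (fun w => a * f w)%C (fun w => b * g w)%C); now apply is_Cderive_scal.
Qed.

Lemma is_Cderive_ext_disk (f g : C -> C) (z l : C) :
  disk z -> (forall w, disk w -> f w = g w) ->
  is_Cderive f z l -> is_Cderive g z l.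
Proof.
  intros Hz E. apply is_derive_ext_loc.
  assert (Hr : 0 < 1 - Cmod z) by (unfold disk in Hz; lra).
  exists (mkposreal _ Hr). intros w Hw. apply E.
  change (Cmod (w - z)%C < 1 - Cmod z) in Hw. unfold disk.
  replace w with ((w - z) + z)%C by ring.
  pose proof (Cmod_triangle (w - z) z). lra.
Qed.

Lemma C_derive_is_Cderive (f : C -> C) (z : C) :
  ex_derive (K := C_AbsRing) (V := C_NormedModule) f z -> is_Cderive f z (C_derive f z).
Proof.
  intros H. exact (C_derive_correct f z z H).
Qed.

(** * The complex exponential *)

Lemma Cexp_0 : Cexp 0 = 1.
Proof. unfold Cexp; simpl. rewrite exp_0, cos_0, sin_0. unfold RtoC; f_equal; ring. Qed.

Lemma Cexp_plus (z w : C) : Cexp (z + w) = (Cexp z * Cexp w)%C.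
Proof.
  destruct z as [x y], w as [x' y'].
  unfold Cexp, Cmult, Cplus; simpl.
  rewrite exp_plus, cos_plus, sin_plus. f_equal; ring.
Qed.

Lemma Cexp_neq_0 (z : C) : Cexp z <> 0.
Proof.
  intros E.
  assert (E1 : (Cexp z * Cexp (- z))%C = 1).
  { rewrite <- Cexp_plus. replace (z + - z)%C with (RtoC 0) by ring.
    exact Cexp_0. }
  rewrite E, Cmult_0_l in E1. apply RtoC_inj in E1. lra.
Qed.

Lemma Cmod_le_Rabs_plus (z : C) : Cmod z <= Rabs (fst z) + Rabs (snd z).
Proof.
  destruct z as [x y]; simpl.
  replace (x, y) with (RtoC x + Ci * RtoC y)%C
    by (unfold RtoC, Ci, Cplus, Cmult; simpl; f_equal; ring).
  eapply Rle_trans; [apply Cmod_triangle|].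
  rewrite Cmod_mult, Cmod_Ci, !Cmod_R. lra.
Qed.

Lemma is_derive_0_epsilon (f : R -> R) (l eps : R) :
  is_derive f 0 l -> 0 < eps -> exists delta : R, 0 < delta /\
    forall t, Rabs t < delta -> Rabs (f t - f 0 - t * l) <= eps * Rabs t.
Proof.
  intros [_ H] Heps.
  destruct (H 0 (fun P HP => HP) (mkposreal eps Heps)) as [d Hd].
  exists d; split; [apply cond_pos|].
  intros t Ht.
  assert (Hb : ball 0 d t).
  { change (Rabs (t - 0) < d). now rewrite Rminus_0_r. }
  specialize (Hd t Hb).
  change (Rabs (f t - f 0 - (t - 0) * l) <= eps * Rabs (t - 0)) in Hd.
  now rewrite !Rminus_0_r in Hd.
Qed.

(** Real and imaginary part of [exp (x + iy) - 1 - (x + iy)] are combinations of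
    the first-order Taylor remainders of [exp], [cos] and [sin] at [0] and of the
    second-order term [x sin y]. *)
Lemma is_Cderive_Cexp_0 : is_Cderive Cexp (RtoC 0) (RtoC 1).
Proof.
  apply is_Cderive_epsilon. intros eps Heps.
  (* The remainder is bounded by 3 eta r in the real part and 4 eta r in the
     imaginary part, where r = |w|. *)
  set (eta := Rmin 1 (eps / 7)).
  assert (Heta : 0 < eta) by (apply Rmin_glb_lt; lra).
  assert (H1 : eta <= 1) by apply Rmin_l.
  assert (H7 : 7 * eta <= eps) by (pose proof (Rmin_r 1 (eps / 7)); unfold eta; lra).
  destruct (is_derive_0_epsilon exp 1 eta) as [d1 [Hd1 Bexp]]; [|exact Heta|].
  { auto_derive; [exact I|]. rewrite exp_0; ring. }
  destruct (is_derive_0_epsilon cos 0 eta) as [d2 [Hd2 Bcos]]; [|exact Heta|].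
  { auto_derive; [exact I|]. rewrite sin_0; ring. }
  destruct (is_derive_0_epsilon sin 1 eta) as [d3 [Hd3 Bsin]]; [|exact Heta|].
  { auto_derive; [exact I|]. rewrite cos_0; ring. }
  exists (Rmin eta (Rmin d1 (Rmin d2 d3))).
  split; [apply Rmin_glb_lt; [exact Heta | repeat apply Rmin_glb_lt; assumption]|].
  intros w Hw.
  replace (w - 0)%C with w in * by ring.
  pose proof (Rmax_Cmod w) as Hmax.
  destruct w as [x y].
  set (r := Cmod (x, y)) in *. simpl fst in Hmax; simpl snd in Hmax.
  assert (Hx : Rabs x <= r) by (eapply Rle_trans; [apply Rmax_l | exact Hmax]).
  assert (Hy : Rabs y <= r) by (eapply Rle_trans; [apply Rmax_r | exact Hmax]).
  pose proof (Rmin_l eta (Rmin d1 (Rmin d2 d3))).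
  pose proof (Rmin_r eta (Rmin d1 (Rmin d2 d3))).
  pose proof (Rmin_l d1 (Rmin d2 d3)).
  pose proof (Rmin_r d1 (Rmin d2 d3)).
  pose proof (Rmin_l d2 d3).
  pose proof (Rmin_r d2 d3).
  specialize (Bexp x ltac:(lra)). specialize (Bcos y ltac:(lra)).
  specialize (Bsin y ltac:(lra)).
  rewrite exp_0 in Bexp. rewrite cos_0 in Bcos. rewrite sin_0 in Bsin.
  set (ex := exp x) in *. set (cy := cos y) in *. set (sy := sin y) in *.
  assert (Cy : Rabs cy <= 1) by (apply Rabs_le; apply COS_bound).
  assert (Sy : Rabs sy <= 2 * r).
  { replace sy with ((sy - 0 - y * 1) + y) by ring.
    eapply Rle_trans; [apply Rabs_triang|].
    pose proof (Rabs_pos y). nra. }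
  assert (Sy1 : Rabs sy <= 1) by (apply Rabs_le; apply SIN_bound).
  pose proof (Rabs_pos x). pose proof (Rabs_pos y).
  pose proof (Rabs_pos (ex - 1 - x * 1)). pose proof (Rabs_pos sy).
  pose proof (Rabs_pos cy). pose proof (Rabs_pos (cy - 1 - y * 0)).
  eapply Rle_trans; [apply Cmod_le_Rabs_plus|].
  assert (Hre : fst (Cexp (x, y) - Cexp 0 - (x, y) * 1)%C =
                (ex - 1 - x * 1) * cy + (1 + x) * (cy - 1 - y * 0)).
  { unfold Cexp; simpl. rewrite exp_0, cos_0. fold ex cy. ring. }
  assert (Him : snd (Cexp (x, y) - Cexp 0 - (x, y) * 1)%C =
                (ex - 1 - x * 1) * sy + x * sy + (sy - 0 - y * 1)).
  { unfold Cexp; simpl. rewrite exp_0, sin_0. fold ex sy. ring. }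
  rewrite Hre, Him.
  assert (Bre : Rabs ((ex - 1 - x * 1) * cy + (1 + x) * (cy - 1 - y * 0)) <= 3 * (eta * r)).
  { eapply Rle_trans; [apply Rabs_triang|]. rewrite !Rabs_mult.
    assert (Rabs (1 + x) <= 2).
    { eapply Rle_trans; [apply Rabs_triang|]. rewrite Rabs_R1. lra. }
    pose proof (Rabs_pos (1 + x)). nra. }
  assert (Bim : Rabs ((ex - 1 - x * 1) * sy + x * sy + (sy - 0 - y * 1)) <= 4 * (eta * r)).
  { eapply Rle_trans; [apply Rabs_triang|].
    eapply Rle_trans; [apply Rplus_le_compat_r, Rabs_triang|]. rewrite !Rabs_mult.
    assert (Rabs x * Rabs sy <= eta * (2 * r)) by (apply Rmult_le_compat; lra).
    nra. }
  assert (0 <= r) by apply Cmod_ge_0.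
  nra.
Qed.

Lemma is_Cderive_Cexp (z : C) : is_Cderive Cexp z (Cexp z).
Proof.
  apply is_Cderive_epsilon. intros eps Heps.
  assert (Hpos : 0 < Cmod (Cexp z)) by (apply Cmod_gt_0, Cexp_neq_0).
  destruct (proj1 (is_Cderive_epsilon _ _ _) is_Cderive_Cexp_0 (eps / Cmod (Cexp z)))
    as [d [Hd B]]; [apply Rdiv_lt_0_compat; assumption|].
  exists d; split; [exact Hd|]. intros w Hw.
  specialize (B (w - z)%C). replace (w - z - 0)%C with (w - z)%C in B by ring.
  specialize (B Hw).
  rewrite Cexp_0 in B.
  replace (Cexp w) with (Cexp z * Cexp (w - z))%C
    by (rewrite <- Cexp_plus; f_equal; ring).
  replace (Cexp z * Cexp (w - z) - Cexp z - (w - z) * Cexp z)%C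
    with (Cexp z * (Cexp (w - z) - 1 - (w - z) * 1))%C by ring.
  rewrite Cmod_mult.
  apply Rle_trans with (Cmod (Cexp z) * (eps / Cmod (Cexp z) * Cmod (w - z)%C)).
  - apply Rmult_le_compat_l; lra.
  - right. field. lra.
Qed.

(** * Moebius automorphisms of the disk *)

Definition mobius (a z : C) : C := ((z + a) / (1 + Cconj a * z))%C.

Lemma Cmod_one_plus_ge (p : C) : 1 - Cmod p <= Cmod (1 + p)%C.
Proof.
  pose proof (Cmod_triangle (1 + p) (- p)) as H.
  replace (1 + p + - p)%C with (RtoC 1) in H by ring.
  rewrite Cmod_1, Cmod_opp in H. lra.
Qed.

Lemma mobius_den_lower (a z : C) :
  disk z -> 1 - Cmod a <= Cmod (1 + Cconj a * z)%C.
Proof.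
  unfold disk; intros Hz.
  pose proof (Cmod_one_plus_ge (Cconj a * z)) as H.
  rewrite Cmod_mult, Cmod_conj in H.
  pose proof (Cmod_ge_0 a). nra.
Qed.

Lemma mobius_den_neq_0 (a z : C) :
  disk a -> disk z -> (1 + Cconj a * z)%C <> 0.
Proof.
  intros Ha Hz. apply Cmod_gt_0.
  pose proof (mobius_den_lower a z Hz). unfold disk in Ha. lra.
Qed.

Lemma one_minus_conj_mult_neq_0 (a : C) : disk a -> (1 - Cconj a * a)%C <> 0.
Proof.
  intros Ha. rewrite (Cmult_comm (Cconj a)), <- Cmod2_conj, <- RtoC_minus.
  intros E. apply RtoC_inj in E.
  unfold disk in Ha. pose proof (Cmod_ge_0 a). nra.
Qed.

Lemma disk_opp (a : C) : disk a -> disk (- a)%C.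
Proof. unfold disk. now rewrite Cmod_opp. Qed.

(** This is the equality case of the Schwarz-Pick lemma: the fraction
    [(1 - |a|^2) / |1 + conj a z|^2] on the right is the modulus of the derivative of
    [mobius a] at [z], so [(1 - |z|^2) |v'(z)|] is invariant under automorphisms. *)
Lemma one_minus_Cmod_mobius (a z : C) : disk a -> disk z ->
  1 - Cmod (mobius a z) ^ 2 =
  (1 - Cmod a ^ 2) * (1 - Cmod z ^ 2) / Cmod (1 + Cconj a * z)%C ^ 2.
Proof.
  intros Ha Hz. pose proof (mobius_den_neq_0 a z Ha Hz) as Hd.
  unfold mobius. rewrite Cmod_div by exact Hd.
  apply Cmod_gt_0 in Hd.
  assert (E : Cmod (1 + Cconj a * z)%C ^ 2 - Cmod (z + a)%C ^ 2 =
              (1 - Cmod a ^ 2) * (1 - Cmod z ^ 2)).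
  { rewrite !Cmod2_alt. destruct a, z. simpl. ring. }
  rewrite <- E. field. lra.
Qed.

Lemma mobius_disk (a z : C) : disk a -> disk z -> disk (mobius a z).
Proof.
  intros Ha Hz. pose proof (one_minus_Cmod_mobius a z Ha Hz) as E.
  pose proof (mobius_den_neq_0 a z Ha Hz) as Hd. apply Cmod_gt_0 in Hd.
  assert (0 < 1 - Cmod (mobius a z) ^ 2).
  { rewrite E. unfold disk in *. pose proof (Cmod_ge_0 a). pose proof (Cmod_ge_0 z).
    apply Rdiv_lt_0_compat; [apply Rmult_lt_0_compat; nra | nra]. }
  unfold disk. pose proof (Cmod_ge_0 (mobius a z)). nra.
Qed.

Lemma mobius_0 (a : C) : mobius a 0 = a.
Proof. unfold mobius. field. Qed.

Lemma mobius_opp_inv (a b : C) : disk a -> disk b -> mobius a (mobius (- a) b) = b.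
Proof.
  intros Ha Hb.
  pose proof (mobius_den_neq_0 (- a) b (disk_opp a Ha) Hb) as H1.
  pose proof (one_minus_conj_mult_neq_0 a Ha) as H2.
  unfold mobius. rewrite Copp_conj in *.
  field. split; [exact H1|].
  replace (1 + - Cconj a * b + Cconj a * (b + - a))%C with (1 - Cconj a * a)%C by ring.
  exact H2.
Qed.

Lemma pseudo_hyp_mobius (a b : C) : disk a -> disk b ->
  pseudo_hyp a b = Cmod (mobius (- a) b).
Proof.
  intros Ha Hb. unfold pseudo_hyp, mobius.
  rewrite <- Cmod_opp. f_equal. rewrite Copp_conj.
  pose proof (mobius_den_neq_0 (- a) b (disk_opp a Ha) Hb) as H1.
  rewrite Copp_conj in H1.
  field. exact H1.
Qed.

(** The Taylor remainder of a Moebius map is explicit: it is [(w - z)^2] times a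
    factor that is bounded on the disk because the denominators stay away
    from [0]. *)
Lemma is_Cderive_mobius (a z : C) : disk a -> disk z ->
  is_Cderive (mobius a) z ((1 - Cconj a * a) / ((1 + Cconj a * z) * (1 + Cconj a * z)))%C.
Proof.
  intros Ha Hz. apply is_Cderive_epsilon. intros eps Heps.
  set (m := 1 - Cmod a). assert (Hm : 0 < m) by (unfold m, disk in *; lra).
  set (K := Cmod (Cconj a * (1 - Cconj a * a))%C / m ^ 3).
  assert (HK : 0 <= K).
  { apply Rmult_le_pos; [apply Cmod_ge_0|]. apply Rlt_le, Rinv_0_lt_compat, pow_lt, Hm. }
  exists (Rmin (1 - Cmod z) (eps / (K + 1))).
  assert (Hz1 : 0 < 1 - Cmod z) by (unfold disk in Hz; lra).
  split.
  { apply Rmin_glb_lt; [exact Hz1|]. apply Rdiv_lt_0_compat; lra. }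
  intros w Hw.
  assert (Dw : disk w).
  { unfold disk. replace w with ((w - z) + z)%C by ring.
    pose proof (Cmod_triangle (w - z) z).
    pose proof (Rmin_l (1 - Cmod z) (eps / (K + 1))). lra. }
  pose proof (mobius_den_neq_0 a z Ha Hz) as Nz.
  pose proof (mobius_den_neq_0 a w Ha Dw) as Nw.
  pose proof (mobius_den_lower a z Hz) as Lz. fold m in Lz.
  pose proof (mobius_den_lower a w Dw) as Lw. fold m in Lw.
  set (D := ((1 + Cconj a * z) * (1 + Cconj a * z) * (1 + Cconj a * w))%C).
  assert (ND : D <> 0) by (unfold D; repeat apply Cmult_neq_0; assumption).
  assert (LD : m ^ 3 <= Cmod D).
  { unfold D. rewrite !Cmod_mult.
    replace (m ^ 3) with (m * m * m) by ring.
    apply Rmult_le_compat; try apply Rmult_le_compat; nra. }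
  replace (mobius a w - mobius a z
           - (w - z) * ((1 - Cconj a * a) / ((1 + Cconj a * z) * (1 + Cconj a * z))))%C
    with (- ((w - z) * (w - z) * ((Cconj a * (1 - Cconj a * a)) / D)))%C.
  2: { unfold mobius, D. field. split; assumption. }
  rewrite Cmod_opp, !Cmod_mult, Cmod_div by exact ND.
  set (r := Cmod (w - z)%C) in *. assert (Hr : 0 <= r) by apply Cmod_ge_0.
  assert (HB : Cmod (Cconj a * (1 - Cconj a * a))%C / Cmod D <= K).
  { apply Rmult_le_compat_l; [apply Cmod_ge_0|].
    apply Rinv_le_contravar; [apply pow_lt, Hm | exact LD]. }
  assert (Hr' : r * (K + 1) <= eps).
  { pose proof (Rmin_r (1 - Cmod z) (eps / (K + 1))).
    replace eps with (eps / (K + 1) * (K + 1)) by (field; lra).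
    apply Rmult_le_compat_r; lra. }
  apply Rle_trans with (r * (r * (K + 1))).
  - rewrite Rmult_assoc. apply Rmult_le_compat_l; [exact Hr|].
    apply Rmult_le_compat_l; lra.
  - rewrite (Rmult_comm eps). apply Rmult_le_compat_l; lra.
Qed.

(** * Growth along the radii of the disk *)

Definition artanh (r : R) : R := / 2 * ln ((1 + r) / (1 - r)).

Lemma artanh_0 : artanh 0 = 0.
Proof. unfold artanh. replace ((1 + 0) / (1 - 0)) with 1 by field. rewrite ln_1. ring. Qed.

Lemma is_derive_artanh (k t : R) : -1 < t * k < 1 ->
  is_derive (fun s => artanh (s * k)) t (k / (1 - (t * k) ^ 2)).
Proof.
  intros H. unfold artanh. auto_derive.
  - split; [lra|]. split; [|exact I]. apply Rdiv_lt_0_compat; lra.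
  - field. repeat split; nra.
Qed.

(** Real-valued functions of this form make the mean value theorem available to
    complex-valued [v]: with [c] the conjugate of a vector, the real part of
    [c v] measures [v] in the direction of that vector. *)
Lemma is_derive_Re_ray (v : C -> C) (c w l : C) (t : R) :
  is_Cderive v (RtoC t * w)%C l ->
  is_derive (fun s : R => Re (c * v (RtoC s * w))%C) t (Re (c * (w * l))%C).
Proof.
  intros H. split; [apply (is_linear_scal_l (K := R_AbsRing) (V := R_NormedModule))|].
  intros x Hx.
  apply (is_filter_lim_locally_unique (K := R_AbsRing) (V := R_NormedModule)) in Hx. subst x.
  intros [eps Heps].
  set (K := Cmod c * Cmod w + 1).
  assert (HK : 0 < K).
  { unfold K. pose proof (Rmult_le_pos _ _ (Cmod_ge_0 c) (Cmod_ge_0 w)). lra. }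
  destruct (proj1 (is_Cderive_epsilon _ _ _) H (eps / K)) as [d [Hd B]];
    [apply Rdiv_lt_0_compat; assumption|].
  assert (Hd' : 0 < d / (Cmod w + 1)).
  { apply Rdiv_lt_0_compat; [exact Hd|]. pose proof (Cmod_ge_0 w); lra. }
  exists (mkposreal _ Hd'). intros s Hs.
  change (Rabs (s - t) < d / (Cmod w + 1)) in Hs.
  change (Rabs (Re (c * v (RtoC s * w))%C - Re (c * v (RtoC t * w))%C
                - (s - t) * Re (c * (w * l))%C) <= eps * Rabs (s - t)).
  assert (Es : (RtoC s * w - RtoC t * w)%C = (RtoC (s - t) * w)%C)
    by (rewrite RtoC_minus; ring).
  assert (Em : Cmod (RtoC s * w - RtoC t * w)%C = Rabs (s - t) * Cmod w)
    by now rewrite Es, Cmod_mult, Cmod_R.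
  specialize (B (RtoC s * w)%C). rewrite Em in B.
  assert (Hlt : Rabs (s - t) * Cmod w < d).
  { pose proof (Cmod_ge_0 w). pose proof (Rabs_pos (s - t)).
    assert (Rabs (s - t) * (Cmod w + 1) < d).
    { replace d with (d / (Cmod w + 1) * (Cmod w + 1)) by (field; lra).
      apply Rmult_lt_compat_r; lra. }
    nra. }
  specialize (B Hlt). rewrite Es in B.
  replace (Re (c * v (RtoC s * w))%C - Re (c * v (RtoC t * w))%C
           - (s - t) * Re (c * (w * l))%C)
    with (Re (c * (v (RtoC s * w) - v (RtoC t * w) - RtoC (s - t) * w * l))%C).
  2: { destruct c, w, l, (v (RtoC s * (r1, r2))%C), (v (RtoC t * (r1, r2))%C).
       simpl. ring. }
  eapply Rle_trans; [apply re_le_Cmod|]. rewrite Cmod_mult.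
  apply Rle_trans with (Cmod c * (eps / K * (Rabs (s - t) * Cmod w))).
  { apply Rmult_le_compat_l; [apply Cmod_ge_0 | exact B]. }
  replace (Cmod c * (eps / K * (Rabs (s - t) * Cmod w)))
    with (Cmod c * Cmod w / K * (eps * Rabs (s - t))) by (field; lra).
  rewrite <- (Rmult_1_l (eps * Rabs (s - t))) at 2.
  apply Rmult_le_compat_r; [pose proof (Rabs_pos (s - t)); nra|].
  apply Rmult_le_reg_r with K; [exact HK|].
  unfold Rdiv. rewrite Rmult_assoc, Rinv_l by lra. unfold K; lra.
Qed.

Lemma Re_conj_mult_self (c : C) : Re (Cconj c * c)%C = Cmod c ^ 2.
Proof. rewrite Cmod2_alt. destruct c; simpl; ring. Qed.

(** With [c = v(w) - v(0)], the function
    [q(t) = |c| M artanh (t |w|) - Re (conj c v(t w))] is nondecreasing on [[0, 1]],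
    because [|w v'(t w)| <= M |w| / (1 - t^2 |w|^2)].  Comparing its end values
    gives [|c|^2 <= |c| M artanh |w|]. *)
Lemma growth_of_derivative_bound (v v' : C -> C) (M : R) (w : C) :
  (forall z, disk z -> is_Cderive v z (v' z)) ->
  (forall z, disk z -> (1 - Cmod z ^ 2) * Cmod (v' z) <= M) ->
  disk w -> Cmod (v w - v 0)%C <= M * artanh (Cmod w).
Proof.
  intros Hv HM Hw.
  set (r := Cmod w). assert (Hr : 0 <= r < 1) by (split; [apply Cmod_ge_0 | exact Hw]).
  set (c := (v w - v 0)%C).
  assert (Hray : forall t, 0 <= t <= 1 -> disk (RtoC t * w)%C /\ Cmod (RtoC t * w)%C = t * r).
  { intros t Ht. assert (E : Cmod (RtoC t * w)%C = t * r).
    { rewrite Cmod_mult, Cmod_R, Rabs_pos_eq by lra. reflexivity. }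
    split; [unfold disk; rewrite E; nra | exact E]. }
  set (q := fun t => Cmod c * (M * artanh (t * r)) - Re (Cconj c * v (RtoC t * w))%C).
  set (q' := fun t => Cmod c * (M * (r / (1 - (t * r) ^ 2)))
                      - Re (Cconj c * (w * v' (RtoC t * w)))%C).
  assert (Dq : forall t, 0 <= t <= 1 -> is_derive q t (q' t)).
  { intros t Ht. destruct (Hray t Ht) as [Dt Et].
    apply (is_derive_minus (K := R_AbsRing) (V := R_NormedModule)).
    - apply is_derive_scal, is_derive_scal, is_derive_artanh.
      unfold disk in Dt. rewrite Et in Dt. nra.
    - apply is_derive_Re_ray, Hv, Dt. }
  destruct (MVT_gen q 0 1 q') as [s [Hs Es]].
  { rewrite Rmin_left, Rmax_right by lra. intros t Ht. apply Dq. lra. }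
  { rewrite Rmin_left, Rmax_right by lra. intros t Ht.
    apply continuity_pt_filterlim.
    apply (ex_derive_continuous (K := R_AbsRing) (V := R_NormedModule)).
    exists (q' t). apply Dq, Ht. }
  rewrite Rmin_left, Rmax_right in Hs by lra.
  assert (Hq' : 0 <= q' s).
  { destruct (Hray s Hs) as [Ds Ess]. pose proof (HM _ Ds) as B. rewrite Ess in B.
    unfold disk in Ds; rewrite Ess in Ds.
    set (L := Cmod (v' (RtoC s * w)%C)) in *.
    assert (Hden : 0 < 1 - (s * r) ^ 2) by (assert (0 <= s * r) by nra; nra).
    assert (B' : L <= M / (1 - (s * r) ^ 2)).
    { apply Rmult_le_reg_r with (1 - (s * r) ^ 2); [exact Hden|].
      unfold Rdiv. rewrite Rmult_assoc, Rinv_l; lra. }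
    pose proof (re_le_Cmod (Cconj c * (w * v' (RtoC s * w)))%C) as H1.
    rewrite !Cmod_mult, Cmod_conj in H1. fold r L in H1.
    pose proof (Rle_abs (Re (Cconj c * (w * v' (RtoC s * w)))%C)).
    unfold q'.
    replace (M * (r / (1 - (s * r) ^ 2))) with (r * (M / (1 - (s * r) ^ 2))) by (field; lra).
    assert (Cmod c * (r * L) <= Cmod c * (r * (M / (1 - (s * r) ^ 2)))).
    { apply Rmult_le_compat_l; [apply Cmod_ge_0|]. apply Rmult_le_compat_l; lra. }
    lra. }
  assert (Hq : q 0 <= q 1) by nra.
  unfold q in Hq. rewrite Rmult_0_l, Rmult_1_l, artanh_0, !Cmult_0_l, Cmult_1_l in Hq.
  assert (Hsq : Cmod c ^ 2 = Re (Cconj c * v w)%C - Re (Cconj c * v 0)%C).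
  { rewrite <- Re_conj_mult_self. unfold c at 2.
    destruct (Cconj c), (v w), (v 0). simpl. ring. }
  assert (HM0 : 0 <= M).
  { assert (D0 : disk 0) by (unfold disk; rewrite Cmod_0; lra).
    pose proof (HM _ D0) as B. rewrite Cmod_0 in B.
    pose proof (Cmod_ge_0 (v' 0)). lra. }
  assert (HA : 0 <= artanh r).
  { unfold artanh. apply Rmult_le_pos; [lra|]. rewrite <- ln_1.
    assert (1 <= (1 + r) / (1 - r)).
    { apply Rmult_le_reg_r with (1 - r); [lra|].
      unfold Rdiv. rewrite Rmult_assoc, Rinv_l; lra. }
    apply ln_le; lra. }
  pose proof (Cmod_ge_0 c). pose proof (Rmult_le_pos _ _ HM0 HA).
  destruct (Req_dec (Cmod c) 0) as [Z | NZ]; [lra|].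
  apply Rmult_le_reg_l with (Cmod c); nra.
Qed.

Lemma derive_nonneg_at_min (q : R -> R) (l : R) :
  is_derive q 0 l -> q 0 = 0 -> (forall t, 0 <= t < 1 -> 0 <= q t) -> 0 <= l.
Proof.
  intros Hq H0 Hpos. destruct (Rle_lt_dec 0 l) as [|Hl]; [assumption|exfalso].
  destruct (is_derive_0_epsilon q l (- l / 2) Hq) as [d [Hd B]]; [lra|].
  set (t := Rmin (1 / 2) (d / 2)).
  assert (Ht : 0 < t) by (apply Rmin_glb_lt; lra).
  pose proof (Rmin_l (1 / 2) (d / 2)) as T1. pose proof (Rmin_r (1 / 2) (d / 2)) as T2.
  fold t in T1, T2.
  specialize (B t). rewrite H0, (Rabs_pos_eq t) in B by lra.
  specialize (B ltac:(lra)). pose proof (Rle_abs (q t - 0 - t * l)).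
  pose proof (Hpos t ltac:(lra)). nra.
Qed.

(** The function [|l| M artanh t - Re (conj l (v(t) - v(0)))] vanishes at [0] and is
    nonnegative to the right of it, so its derivative at [0], which is
    [|l| M - |l|^2], is nonnegative. *)
Lemma derivative_bound_of_growth (v : C -> C) (l : C) (M : R) :
  is_Cderive v (RtoC 0) l ->
  (forall z, disk z -> Cmod (v z - v 0)%C <= M * artanh (Cmod z)) ->
  Cmod l <= M.
Proof.
  intros Hv HM.
  set (q := fun t => Cmod l * (M * artanh (t * 1))
                     - (Re (Cconj l * v (RtoC t * 1))%C - Re (Cconj l * v 0)%C)).
  assert (Hl : 0 <= Cmod l * (M * (1 / (1 - (0 * 1) ^ 2)))
                    - (Re (Cconj l * (1 * l))%C - 0)).
  { apply (derive_nonneg_at_min q).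
    - apply (is_derive_minus (K := R_AbsRing) (V := R_NormedModule)).
      + apply is_derive_scal, is_derive_scal, is_derive_artanh. lra.
      + apply (is_derive_minus (K := R_AbsRing) (V := R_NormedModule)).
        * apply is_derive_Re_ray. now rewrite Cmult_0_l.
        * apply (is_derive_const (K := R_AbsRing) (V := R_NormedModule)).
    - unfold q. rewrite Rmult_0_l, artanh_0, Cmult_0_l. ring.
    - intros t Ht. unfold q. rewrite Rmult_1_r, Cmult_1_r.
      assert (Et : Cmod (RtoC t) = t) by (rewrite Cmod_R; apply Rabs_pos_eq; lra).
      assert (Dt : disk (RtoC t)) by (unfold disk; lra).
      pose proof (HM _ Dt) as B. rewrite Et in B.
      assert (E : Re (Cconj l * v (RtoC t))%C - Re (Cconj l * v 0)%C
                  = Re (Cconj l * (v (RtoC t) - v 0))%C)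
        by (destruct (Cconj l), (v (RtoC t)), (v 0); simpl; ring).
      rewrite E.
      pose proof (re_le_Cmod (Cconj l * (v (RtoC t) - v 0))%C) as H1.
      rewrite Cmod_mult, Cmod_conj in H1.
      pose proof (Rle_abs (Re (Cconj l * (v (RtoC t) - v 0))%C)).
      pose proof (Rmult_le_compat_l _ _ _ (Cmod_ge_0 l) B). lra. }
  rewrite Cmult_1_l, Re_conj_mult_self in Hl.
  replace (1 / (1 - (0 * 1) ^ 2)) with 1 in Hl by field.
  pose proof (Cmod_ge_0 l).
  destruct (Req_dec (Cmod l) 0) as [Z | NZ].
  (* If l = 0 one must still see that M >= 0: evaluate the growth bound at 1/2. *)
  - assert (D : disk (RtoC (/ 2))) by (unfold disk; rewrite Cmod_R, Rabs_pos_eq; lra).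
    pose proof (HM _ D) as B. rewrite Cmod_R, Rabs_pos_eq in B by lra.
    pose proof (Cmod_ge_0 (v (RtoC (/ 2)) - v 0)%C).
    assert (0 < artanh (/ 2)).
    { unfold artanh. apply Rmult_lt_0_compat; [lra|]. rewrite <- ln_1.
      apply ln_increasing; lra. }
    rewrite Z. nra.
  - apply Rmult_le_reg_l with (Cmod l); nra.
Qed.

(** * Hyperbolic Lipschitz functions *)

(** Precomposing with [mobius a] moves the base point [a] to the origin, keeps
    hyperbolic distances ([pseudo_hyp_mobius]) and keeps the weighted derivative
    ([one_minus_Cmod_mobius]); at the origin the two growth estimates apply. *)
Lemma hyperbolic_lipschitz_iff (u : C -> C) (M : R) :
  analytic_on_disk u ->
  (forall z, disk z -> (1 - Cmod z ^ 2) * Cmod (C_derive u z) <= M) <->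
  (forall z1 z2, disk z1 -> disk z2 -> Cmod (u z1 - u z2)%C <= M * hyp_dist z1 z2).
Proof.
  intros Hu.
  assert (D0 : disk 0) by (unfold disk; rewrite Cmod_0; lra).
  assert (Hv : forall a z, disk a -> disk z ->
    is_Cderive (fun w => u (mobius a w)) z
      ((1 - Cconj a * a) / ((1 + Cconj a * z) * (1 + Cconj a * z))
       * C_derive u (mobius a z))%C).
  { intros a z Ha Hz. apply is_Cderive_comp; [|now apply is_Cderive_mobius].
    apply C_derive_is_Cderive, Hu. now apply mobius_disk. }
  assert (Ha2 : forall a, disk a -> Cmod (1 - Cconj a * a)%C = 1 - Cmod a ^ 2).
  { intros a Ha.
    rewrite (Cmult_comm (Cconj a)), <- Cmod2_conj, <- RtoC_minus, Cmod_R.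
    apply Rabs_pos_eq. unfold disk in Ha. pose proof (Cmod_ge_0 a). nra. }
  split.
  - intros HM z1 z2 H1 H2.
    pose proof (disk_opp z1 H1) as H1'.
    change (hyp_dist z1 z2) with (artanh (pseudo_hyp z1 z2)).
    rewrite pseudo_hyp_mobius by assumption.
    pose proof (mobius_disk (- z1) z2 H1' H2) as Hw.
    pose proof (growth_of_derivative_bound (fun w => u (mobius z1 w)) _ M
                  (mobius (- z1) z2) (fun z Hz => Hv z1 z H1 Hz)) as B.
    cbv beta in B.
    rewrite mobius_opp_inv, mobius_0 in B by assumption.
    rewrite <- Cmod_opp. replace (- (u z1 - u z2))%C with (u z2 - u z1)%C by ring.
    apply B; [|exact Hw]. intros z Hz.
    pose proof (HM _ (mobius_disk z1 z H1 Hz)) as B1.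
    rewrite one_minus_Cmod_mobius in B1 by assumption.
    pose proof (mobius_den_neq_0 z1 z H1 Hz) as Hd.
    rewrite Cmod_mult, Cmod_div, Ha2, Cmod_mult by (try apply Cmult_neq_0; assumption).
    apply Cmod_gt_0 in Hd.
    eapply Rle_trans; [right | exact B1]. field. lra.
  - intros HL a Ha.
    pose proof (Hv a 0 Ha D0) as Hd.
    replace ((1 - Cconj a * a) / ((1 + Cconj a * 0) * (1 + Cconj a * 0))
             * C_derive u (mobius a 0))%C
      with ((1 - Cconj a * a) * C_derive u a)%C in Hd.
    2: { rewrite mobius_0, Cmult_0_r. field. }
    rewrite <- Ha2, <- Cmod_mult by exact Ha.
    apply (derivative_bound_of_growth _ _ M Hd).
    intros z Hz. rewrite mobius_0.
    pose proof (mobius_disk a z Ha Hz) as Hz'.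
    pose proof (HL a (mobius a z) Ha Hz') as B.
    change (hyp_dist a (mobius a z)) with (artanh (pseudo_hyp a (mobius a z))) in B.
    rewrite pseudo_hyp_mobius in B by assumption.
    replace (mobius (- a) (mobius a z)) with z in B.
    2: { rewrite <- (mobius_opp_inv (- a) z) at 1 by (try apply disk_opp; assumption).
         now replace (- - a)%C with a by ring. }
    rewrite <- Cmod_opp. now replace (- (u (mobius a z) - u a))%C
      with (u a - u (mobius a z))%C by ring.
Qed.

(** * The family of logarithms *)

Lemma is_Cderive_exp_of_log (F u : C -> C) (z : C) :
  log_branch F u -> disk z -> is_Cderive F z (C_derive u z * F z)%C.
Proof.
  intros [Hu E] Hz.
  apply is_Cderive_ext_disk with (fun w => Cexp (u w)); [exact Hz | exact E|].
  rewrite <- (E z Hz).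
  apply is_Cderive_comp; [apply is_Cderive_Cexp | apply C_derive_is_Cderive, Hu, Hz].
Qed.

(** Logarithms for all angles are assumed, and not just for [theta], because the
    differentiability of [h'] and [g'] separately is read off from the angles [0]
    and [pi]. *)
Lemma C_derive_log_rot_sum (h g : C -> C) (u : R -> C -> C) (theta : R) (z : C) :
  (forall t : R, angle t -> log_branch (rot_sum (C_derive h) (C_derive g) t) (u t)) ->
  angle theta -> disk z ->
  (rot_sum (C_derive (C_derive h)) (C_derive (C_derive g)) theta z
     / rot_sum (C_derive h) (C_derive g) theta z)%C = C_derive (u theta) z.
Proof.
  intros hu Ht Hz.
  pose proof PI_RGT_0 as Hpi.
  assert (E0 : Cexp (Ci * RtoC 0) = 1).
  { rewrite Cmult_0_r. exact Cexp_0. }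
  assert (Epi : Cexp (Ci * RtoC PI) = (- (1))%C).
  { unfold Cexp; simpl. replace (0 * PI - 1 * 0) with 0 by ring.
    replace (0 * 0 + 1 * PI) with PI by ring.
    rewrite exp_0, cos_PI, sin_PI. unfold RtoC, Copp; simpl; f_equal; ring. }
  assert (A0 : angle 0) by (unfold angle; lra).
  assert (Api : angle PI) by (unfold angle; lra).
  pose proof (is_Cderive_exp_of_log _ _ z (hu 0 A0) Hz) as F0.
  pose proof (is_Cderive_exp_of_log _ _ z (hu PI Api) Hz) as Fpi.
  assert (Hh : ex_derive (K := C_AbsRing) (V := C_NormedModule) (C_derive h) z).
  { eexists. eapply is_derive_ext; [|exact (is_Cderive_lincomb (/ 2) (/ 2) _ _ z _ _ F0 Fpi)].
    intros w. unfold rot_sum. rewrite E0, Epi. simpl. field. }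
  assert (Hg : ex_derive (K := C_AbsRing) (V := C_NormedModule) (C_derive g) z).
  { eexists. eapply is_derive_ext; [|exact (is_Cderive_lincomb (/ 2) (- / 2) _ _ z _ _ F0 Fpi)].
    intros w. unfold rot_sum. rewrite E0, Epi. simpl. field. }
  assert (D : C_derive (rot_sum (C_derive h) (C_derive g) theta) z =
              rot_sum (C_derive (C_derive h)) (C_derive (C_derive g)) theta z).
  { apply is_C_derive_unique.
    pose proof (is_Cderive_lincomb 1 (Cexp (Ci * RtoC theta)) _ _ z _ _
      (C_derive_is_Cderive _ _ Hh) (C_derive_is_Cderive _ _ Hg)) as Hd.
    rewrite Cmult_1_l in Hd.
    eapply is_derive_ext; [|exact Hd].
    intros w. unfold rot_sum. now rewrite Cmult_1_l. }
  rewrite <- D.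
  rewrite (is_C_derive_unique _ _ _ (is_Cderive_exp_of_log _ _ z (hu theta Ht) Hz)).
  field.
  rewrite <- (proj2 (hu theta Ht) z Hz). apply Cexp_neq_0.
Qed.

Lemma T_norm_le_iff (h g : C -> C) (M : R) :
  (forall (z : C) (theta : R), disk z -> angle theta ->
     rot_sum (C_derive h) (C_derive g) theta z <> RtoC 0) ->
  Rbar_le (T_norm h g) (Finite M) <->
  (forall (z : C) (theta : R), disk z -> angle theta ->
     (1 - Cmod z ^ 2) *
       Cmod (rot_sum (C_derive (C_derive h)) (C_derive (C_derive g)) theta z
             / rot_sum (C_derive h) (C_derive g) theta z)%C <= M).
Proof.
  intros Hnz. unfold T_norm.
  destruct (ClassicalEpsilon.excluded_middle_informative _) as [[z [t [Hz [Ht E]]]] | _].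
  { exfalso. exact (Hnz z t Hz Ht E). }
  match goal with |- context [Lub_Rbar ?E] =>
    destruct (Lub_Rbar_correct E) as [Hub Hleast] end.
  split.
  - intros HM z t Hz Ht.
    refine (Rbar_le_trans (Finite _) _ (Finite M) (Hub _ _) HM). now exists z, t.
  - intros HM. apply Hleast. intros r [z [t [Hz [Ht E]]]]. rewrite E. now apply HM.
Qed.

Theorem corollary1p1 (lambda : R) (hlambda : 0 < lambda)
  (h g : C -> C) (hH : class_H h g)
  (hlu : locally_univalent (harmonic_map h g))
  (u : R -> C -> C)
  (hu : forall theta : R, angle theta ->
     log_branch (rot_sum (C_derive h) (C_derive g) theta) (u theta)) :
  class_B_H lambda h g <->
  (forall z1 z2 : C, disk z1 -> disk z2 ->
   forall theta : R, angle theta ->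
     Cmod (u theta z1 - u theta z2)%C <= 2 * lambda * hyp_dist z1 z2).
Proof.
  assert (Hnz : forall (z : C) (theta : R), disk z -> angle theta ->
     rot_sum (C_derive h) (C_derive g) theta z <> RtoC 0).
  { intros z t Hz Ht. rewrite <- (proj2 (hu t Ht) z Hz). apply Cexp_neq_0. }
  unfold class_B_H. rewrite (T_norm_le_iff h g (2 * lambda) Hnz). split.
  - intros [_ HT] z1 z2 H1 H2 t Ht.
    apply (proj1 (hyperbolic_lipschitz_iff (u t) (2 * lambda) (proj1 (hu t Ht)))); try assumption.
    intros z Hz. rewrite <- (C_derive_log_rot_sum h g u t z hu Ht Hz). now apply HT.
  - intros HL. split; [exact hH|]. intros z t Hz Ht.
    rewrite (C_derive_log_rot_sum h g u t z hu Ht Hz).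
    apply (proj2 (hyperbolic_lipschitz_iff (u t) (2 * lambda) (proj1 (hu t Ht)))); [|exact Hz].
    intros z1 z2 H1 H2. now apply HL.
Qed.
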